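(* Let $U=\prod_l U_l$ be an $n$-qubit quantum circuit (the gate $U_1$ applied first, then $U_2$, and so on), where $U_l=\exp(-iH_lT_l)$ with runtime $T_l\ge0$ and $H_l$ a time-independent Hamiltonian acting nontrivially only on $k_l$ qubits. Then $\mathcal R(U)\ge \frac12 C_{W_1}(U)$.
   Context: For $\mathcal H=(\mathbb C^2)^{\otimes n}$, let $O(\mathcal H)$ be the traceless Hermitian operators and $D(\mathcal H)$ the density operators. For $A\in O(\mathcal H)$, $\|A\|_{W_1}:=\frac12\min\left\{\sum_{i=1}^n\|X_i\|_1 : A=\sum_i X_i,\ X_i\in O(\mathcal H),\ \mathrm{Tr}_i X_i=0\ \forall i\right\}$, with $\mathrm{Tr}_i$ the partial trace over the $i$-th qubit and $\|\cdot\|_1$ the trace norm. $C_{W_1}(U):=\max_{\rho\in D(\mathcal H)}\|\rho-U\rho U^\dagger\|_{W_1}$. Writing the eigenvalues of $H_l$ restricted to its $k_l$-qubit support as $h_1\le\dots\le h_{2^{k_l}}$, set $E_l:=(h_{2^{k_l}}-h_1)/2$. The experimental cost is $\mathcal R(U):=\sum_l k_lE_lT_l$. *)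

(* Defs.v *)
From HB Require Import structures.
From mathcomp Require Import all_boot all_order all_algebra.
From mathcomp Require Import all_classical all_reals all_analysis.
From mathcomp Require Import complex.

Set Implicit Arguments.
Unset Strict Implicit.
Unset Printing Implicit Defensive.

Import Order.TTheory GRing.Theory Num.Theory numFieldNormedType.Exports.
Local Open Scope ring_scope.
Local Open Scope complex_scope.

(* Computational basis of the qubits indexed by a finite type Q:
   bit strings Q -> bool; operators on (C^2)^{tensor Q} are square
   matrices indexed (through enum_rank / enum_val) by these strings. *)
Notation qbasis Q := {ffun Q -> bool}.
Notation qdim Q := #|{ffun Q -> bool}|.

Section QW1.
Variable R : realType.
Local Notation C := R[i].
Local Notation op Q := 'M[C]_(qdim Q).

Definition adjmx m p (A : 'M[C]_(m, p)) : 'M[C]_(p, m) := (map_mx (@conjc R) A)^T.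

Definition herm m (A : 'M[C]_m) : Prop := adjmx A = A.

Definition psd m (A : 'M[C]_m) : Prop :=
  herm A /\ forall v : 'cV[C]_m, 0 <= (adjmx v *m A *m v) 0 0.

Definition sqrtm m (A : 'M[C]_m) : 'M[C]_m :=
  match pselect (exists S : 'M[C]_m, psd S /\ S *m S = A) with
  | left h => projT1 (cid h)
  | right _ => 0
  end.

Definition tnorm m (A : 'M[C]_m) : R := complex.Re (\tr (sqrtm (adjmx A *m A))).

Definition qext n (i : 'I_n) (a : qbasis {j : 'I_n | j != i}) (c : bool)
  : qbasis 'I_n :=
  [ffun j => if (insub j : option {j : 'I_n | j != i}) is Some j' then a j'
             else c].

Definition ptrace n (i : 'I_n) (X : op 'I_n) : op {j : 'I_n | j != i} :=
  \matrix_(a, b) \sum_(c : bool)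
     X (enum_rank (qext (enum_val a) c)) (enum_rank (qext (enum_val b) c)).

Definition W1set n (A : op 'I_n) : set R :=
  [set r | exists X : 'I_n -> op 'I_n,
     [/\ forall i, herm (X i),
         forall i, \tr (X i) = 0,
         forall i, ptrace i (X i) = 0,
         A = \sum_i X i
       & r = 2^-1 * \sum_i tnorm (X i)]].

Definition W1norm n (A : op 'I_n) : R := inf (W1set A).

Definition density m (rho : 'M[C]_m) : Prop := psd rho /\ \tr rho = 1.

Definition CW1 n (U : op 'I_n) : R :=
  sup [set r | exists rho : op 'I_n,
                 density rho /\ r = W1norm (rho - U *m rho *m adjmx U)].

Definition expm_psum m (A : 'M[C]_m) (N : nat) : 'M[C]_m :=
  \sum_(k < N) (k`!%:R)^-1 *: (A ^+ k).

Definition expm m (A : 'M[C]_m) : 'M[C]_m :=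
  \matrix_(a, b)
    ((limn (fun N => complex.Re (expm_psum A N a b)))%:C
     + 'i * (limn (fun N => complex.Im (expm_psum A N a b)))%:C).

Record gate n := Gate {
  gsupp : {set 'I_n};
  gham : op {j : 'I_n | j \in gsupp};
  gtime : R }.

Definition restr n (S : {set 'I_n}) (x : qbasis 'I_n)
  : qbasis {j : 'I_n | j \in S} := [ffun j => x (val j)].

(* h (on the qubits of S) tensor identity (on the other qubits) *)
Definition embed n (S : {set 'I_n}) (h : op {j : 'I_n | j \in S}) : op 'I_n :=
  \matrix_(a, b)
    (let x : qbasis 'I_n := enum_val a in let y : qbasis 'I_n := enum_val b in
     if [forall j, (j \notin S) ==> (x j == y j)]
     then h (enum_rank (restr S x)) (enum_rank (restr S y)) else 0).

Definition gH n (g : gate n) : op 'I_n := embed (gham g).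
Definition gU n (g : gate n) : op 'I_n :=
  expm (- ('i * (gtime g)%:C) *: gH g).

(* U = U_L ... U_2 U_1  (U_1, the head of the list, applied first) *)
Definition circuit n (gs : seq (gate n)) : op 'I_n :=
  foldl (fun U g => gU g *m U) 1%:M gs.

Definition espread m (h : 'M[C]_m) : R :=
  (sup [set r : R | eigenvalue h r%:C] - inf [set r : R | eigenvalue h r%:C]) / 2.

Definition cost n (gs : seq (gate n)) : R :=
  \sum_(g <- gs) (#|gsupp g|)%:R * espread (gham g) * gtime g.

End QW1.

(* Main.v *)
(** Say that a Hermitian [A] is bounded by [r] if [A = P - N] with [P], [N]
    positive and [tr (P + N) <= r]; this bounds the trace norm of [A].

    For a gate [U = exp (-iHT)], replace [U] by a multiple [U'] whose eigenvalues
    are within [E T] of 1.  With [W = 1 - U'] and [Z = 1 + U'],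
    [rho - U rho U^H = (W rho Z^H + Z rho W^H) / 2], and polarization, with [W]
    and [Z] weighted so as to balance the two traces, bounds this by [2 E T].
    The difference vanishes once the [k] qubits of the gate are replaced by the
    maximally mixed state.  Doing so one qubit at a time writes it as a sum of [k]
    operators, each killed by one partial trace and each bounded by [4 E T], so
    its W1 norm is at most [2 k E T].  Summing over the gates gives the claim. *)

Require Import Defs.
From HB Require Import structures.
From mathcomp Require Import all_boot all_order all_algebra.
From mathcomp Require Import all_classical all_reals all_analysis.
From mathcomp Require Import complex.
From mathcomp Require Import spectral sesquilinear ring lra.
From Stdlib Require List.
Import Order.TTheory GRing.Theory Num.Theory.
Import numFieldNormedType.Exports.
Local Open Scope ring_scope.

Set Implicit Arguments.
Unset Strict Implicit.
Unset Printing Implicit Defensive.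

(** * Adjoints, positive matrices and the spectral theorem *)

Section Adjoint.
Local Open Scope complex_scope.
Context {R : realType}.
Local Notation C := R[i].

Lemma adjmxE m p (A : 'M[C]_(m, p)) i j : adjmx A i j = conjc (A j i).
Proof. by rewrite !mxE. Qed.

Lemma adjmxM m p q (A : 'M[C]_(m, p)) (B : 'M[C]_(p, q)) :
  adjmx (A *m B) = adjmx B *m adjmx A.
Proof. by rewrite /adjmx map_mxM trmx_mul. Qed.

Lemma adjmxK m p (A : 'M[C]_(m, p)) : adjmx (adjmx A) = A.
Proof. by apply/matrixP => i j; rewrite !adjmxE conjcK. Qed.

Lemma adjmxD m p (A B : 'M[C]_(m, p)) : adjmx (A + B) = adjmx A + adjmx B.
Proof. by rewrite /adjmx map_mxD linearD. Qed.

Lemma adjmxB m p (A B : 'M[C]_(m, p)) : adjmx (A - B) = adjmx A - adjmx B.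
Proof. by rewrite /adjmx map_mxB linearB. Qed.

Lemma adjmxZ m p c (A : 'M[C]_(m, p)) : adjmx (c *: A) = conjc c *: adjmx A.
Proof. by rewrite /adjmx map_mxZ linearZ. Qed.

Lemma adjmx1 m : adjmx (1%:M : 'M[C]_m) = 1%:M.
Proof. by rewrite /adjmx map_mx1 trmx1. Qed.

Lemma herm_conj m p (M : 'M[C]_(p, m)) (A : 'M[C]_m) :
  herm A -> herm (M *m A *m adjmx M).
Proof. by rewrite /herm !adjmxM adjmxK => ->; rewrite mulmxA. Qed.

Lemma psd_conj m p (M : 'M[C]_(p, m)) (A : 'M[C]_m) :
  psd A -> psd (M *m A *m adjmx M).
Proof.
move=> [hA pA]; split; first exact: herm_conj.
by move=> v; have := pA (adjmx M *m v); rewrite adjmxM adjmxK !mulmxA.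
Qed.

Lemma psd0 m : psd (0 : 'M[C]_m).
Proof.
split; first by rewrite /herm /adjmx map_mx0 trmx0.
by move=> v; rewrite mulmx0 mul0mx mxE.
Qed.

Lemma psdD m (A B : 'M[C]_m) : psd A -> psd B -> psd (A + B).
Proof.
move=> [hA pA] [hB pB]; split; first by rewrite /herm adjmxD hA hB.
by move=> v; rewrite mulmxDr mulmxDl mxE addr_ge0.
Qed.

Lemma psdZ m (c : R) (A : 'M[C]_m) : 0 <= c -> psd A -> psd (c%:C *: A).
Proof.
move=> c0 [hA pA]; split; first by rewrite /herm adjmxZ hA conjc_real.
by move=> v; rewrite -scalemxAr -scalemxAl mxE mulr_ge0 // ler0c.
Qed.

Lemma psd_sum m (I : finType) (F : I -> 'M[C]_m) :
  (forall i, psd (F i)) -> psd (\sum_i F i).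
Proof.
move=> pF; apply: (big_ind (@psd R m)) => [||//].
  exact: psd0.
exact: psdD.
Qed.

Lemma psd_diag_ge0 m (A : 'M[C]_m) i : psd A -> 0 <= A i i.
Proof.
move=> [_ /(_ (delta_mx i 0))]; congr (0 <= _).
rewrite -mulmxA -colE !mxE (bigD1 i) //= big1 => [|j ji].
  by rewrite !mxE !eqxx conjc_nat mul1r addr0.
by rewrite !mxE (negPf ji) conjc_nat mul0r.
Qed.

Lemma psd_tr_ge0 m (A : 'M[C]_m) : psd A -> 0 <= \tr A.
Proof. by move=> pA; apply: sumr_ge0 => i _; exact: psd_diag_ge0. Qed.

(** The spectral theorem for normal matrices, rewritten with [adjmx]; eigenvalues of a Hermitian
    matrix are real, hence given in [R]. *)
Lemma herm_spectral m (A : 'M[C]_m) : herm A ->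
  exists (V : 'M[C]_m) (d : 'I_m -> R),
    [/\ V *m adjmx V = 1%:M, adjmx V *m V = 1%:M
      & A = adjmx V *m diag_mx (\row_j (d j)%:C) *m V].
Proof.
move=> hA.
have adjE (B : 'M[C]_m) : map_mx (@Num.conj C) B^T = adjmx B.
  by rewrite /adjmx map_trmx.
have hs : A \is hermsymmx.
  by rewrite qualifE /= expr0 scale1r; apply/eqP; rewrite -[LHS]hA -adjE.
set V := spectralmx A.
have VV : V *m adjmx V = 1%:M.
  by rewrite -adjE; apply/unitarymxP; exact: spectral_unitarymx.
exists V, (fun j => complex.Re (spectral_diag A 0 j)); split => //.
  exact: mulmx1C.
have /orthomx_spectralP AE := hermitian_normalmx hs.
have invV : invmx V = adjmx V.
  by rewrite -[RHS]mul1mx -(mulVmx (spectral_unit A)) -mulmxA VV mulmx1.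
apply: etrans AE _; rewrite -/V invV.
set d := \row_j _; suff -> : spectral_diag A = d by [].
apply/rowP => j.
have /mxOverP/(_ 0 j) dreal := hermitian_spectral_diag_real hs.
by rewrite /d mxE (RRe_real dreal).
Qed.

End Adjoint.

(** * Trace norm bounds *)

Section TraceNorm.
Local Open Scope complex_scope.
Context {R : realType}.
Local Notation C := R[i].

(** [sqrtm] returns a positive matrix or the default 0, and both have nonnegative trace. *)
Lemma tnorm_ge0 m (A : 'M[C]_m) : 0 <= tnorm A.
Proof.
rewrite /tnorm /sqrtm; case: pselect => [h|_]; last by rewrite mxtrace0.
by case: (cid h) => S [/psd_tr_ge0 + _] /=; rewrite lecE => /andP[].
Qed.

(* Equivalent, by the Jordan decomposition, to [A] being Hermitian with
   [tnorm A <= r], but subadditive and stable under positive maps at sight. *)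
Definition tbound m (A : 'M[C]_m) (r : R) : Prop :=
  exists P N, [/\ psd P, psd N, A = P - N & \tr (P + N) <= r%:C].

Lemma tbound_herm m (A : 'M[C]_m) r : tbound A r -> herm A.
Proof. by case=> P [N [[hP _] [hN _] -> _]]; rewrite /herm adjmxB hP hN. Qed.

Lemma tbound0 m : tbound (0 : 'M[C]_m) 0.
Proof.
by exists 0, 0; split; rewrite ?subr0 ?addr0 ?mxtrace0 //; exact: psd0.
Qed.

Lemma tboundD m (A B : 'M[C]_m) r s :
  tbound A r -> tbound B s -> tbound (A + B) (r + s).
Proof.
move=> [P [N [pP pN -> lr]]] [P' [N' [pP' pN' -> ls]]].
exists (P + P'), (N + N'); split; [exact: psdD|exact: psdD| |].
  by rewrite opprD addrACA.
by rewrite addrACA mxtraceD rmorphD /= lerD.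
Qed.

Lemma tboundN m (A : 'M[C]_m) r : tbound A r -> tbound (- A) r.
Proof.
move=> [P [N [pP pN -> lr]]]; exists N, P.
by split; rewrite ?opprB // addrC.
Qed.

(** In an eigenbasis of [A], any positive root [S] of [A ^+ 2] satisfies
    [S i i ^+ 2 <= (S *m S) i i = d i ^+ 2]. Hence [S i i <= |d i| = |P i i - N i i| <= P i i + N i
    i], and summing over [i] compares the traces. *)
Lemma tnorm_le m (A : 'M[C]_m) r : tbound A r -> tnorm A <= r.
Proof.
move=> tA; have hA := tbound_herm tA; case: tA => P [N [pP pN AE lr]].
have r0 : 0 <= r.
  by rewrite -ler0c; apply: le_trans lr; apply: psd_tr_ge0; exact: psdD.
rewrite /tnorm /sqrtm; case: pselect => [h|_]; last by rewrite mxtrace0.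
case: (cid h) => S [pS SS] /=.
suff: \tr S <= r%:C by rewrite lecE => /andP[].
apply: le_trans lr.
have [V [d [VV1 VV2 AV]]] := herm_spectral hA.
have trV (B : 'M[C]_m) : \tr B = \tr (V *m B *m adjmx V).
  by rewrite mxtrace_mulC mulmxA VV2 mul1mx.
rewrite (trV S) (trV (P + N)) /mxtrace; apply: ler_sum => i _.
set S' := V *m S *m adjmx V.
have pS' : psd S' by exact: psd_conj.
have DE : V *m A *m adjmx V = diag_mx (\row_j (d j)%:C).
  by rewrite AV !mulmxA VV1 mul1mx -mulmxA VV1 mulmx1.
have SdE : S' *m S' = diag_mx (\row_j (d j)%:C) *m diag_mx (\row_j (d j)%:C).
  rewrite -DE /S' !mulmxA -[V *m S *m adjmx V *m V]mulmxA VV2 mulmx1.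
  rewrite -[V *m A *m adjmx V *m V]mulmxA VV2 mulmx1.
  by rewrite -[V *m S *m S]mulmxA SS hA mulmxA.
have Sii : S' i i <= `|d i|%:C.
  rewrite -ler_sqr ?nnegrE ?psd_diag_ge0 ?ler0c //.
  have -> : `|d i|%:C ^+ 2 = (S' *m S') i i.
    rewrite SdE mul_diag_mx !mxE eqxx mulr1n -rmorphXn /= real_normK ?num_real //.
    by rewrite expr2 rmorphM.
  (* As [S'] is Hermitian, a diagonal entry of its square is a sum of squared moduli, one of them
     that of [S' i i]. *)
  rewrite [leRHS]mxE (bigD1 i) //= expr2 lerDl; apply: sumr_ge0 => j _.
  have -> : S' j i = conjc (S' i j) by rewrite -adjmxE pS'.1.
  exact: mulcJ_ge0.
apply: le_trans Sii _.
have -> : `|d i|%:C = `|(V *m P *m adjmx V - V *m N *m adjmx V) i i|.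
  rewrite -mulmxBl -mulmxBr -AE DE !mxE eqxx mulr1n normc_def /=.
  by rewrite expr0n addr0 sqrtr_sqr.
rewrite mulmxDr mulmxDl.
have -> : forall B B' : 'M[C]_m, (B - B') i i = B i i - B' i i.
  by move=> B B'; rewrite !mxE.
have -> : forall B B' : 'M[C]_m, (B + B') i i = B i i + B' i i.
  by move=> B B'; rewrite !mxE.
apply: le_trans (ler_normB _ _) _.
have P0 : 0 <= (V *m P *m adjmx V) i i by apply: psd_diag_ge0; exact: psd_conj.
have N0 : 0 <= (V *m N *m adjmx V) i i by apply: psd_diag_ge0; exact: psd_conj.
by rewrite (ger0_norm P0) (ger0_norm N0).
Qed.

(** In the eigenbasis of [M], the conjugation multiplies the j-th diagonal entry of [rho] by
    [|d j| ^+ 2]. *)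
Lemma mxtrace_conj_le m (V rho M : 'M[C]_m) (d : 'I_m -> C) (c : R) :
  V *m adjmx V = 1%:M -> psd rho -> (forall j, `|d j| <= c%:C) ->
  M = adjmx V *m diag_mx (\row_j d j) *m V ->
  \tr (M *m rho *m adjmx M) <= (c ^+ 2)%:C * \tr rho.
Proof.
move=> VV prho dc ->.
set rho' := V *m rho *m adjmx V.
have -> : \tr rho = \tr rho'.
  by rewrite /rho' mxtrace_mulC mulmxA (mulmx1C VV) mul1mx.
set D := diag_mx (\row_j d j).
have -> : \tr (adjmx V *m D *m V *m rho *m adjmx (adjmx V *m D *m V))
    = \tr (D *m rho' *m adjmx D).
  by rewrite !adjmxM adjmxK -/D !mulmxA mxtrace_mulC !mulmxA VV mul1mx.
rewrite /mxtrace mulr_sumr; apply: ler_sum => j _.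
have -> : (D *m rho' *m adjmx D) j j = `|d j| ^+ 2 * rho' j j.
  rewrite /D mul_diag_mx /adjmx map_diag_mx tr_diag_mx mul_mx_diag !mxE.
  by rewrite sqr_normc mulrAC.
apply: ler_wpM2r; first by apply: psd_diag_ge0; exact: psd_conj.
by rewrite rmorphXn /= lerXn2r ?nnegrE // (le_trans _ (dc j)).
Qed.

(** With [conj_sub], this gives polarization: the difference of the two expansions keeps only the
    cross terms, and their sum cancels them. *)
Lemma conj_add m (A B X : 'M[C]_m) :
  (A + B) *m X *m adjmx (A + B) =
  A *m X *m adjmx A + B *m X *m adjmx B
  + (A *m X *m adjmx B + B *m X *m adjmx A).
Proof.
rewrite adjmxD !(mulmxDl, mulmxDr).
move: (A *m X *m adjmx A) (A *m X *m adjmx B) (B *m X *m adjmx A)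
  (B *m X *m adjmx B) => X1 X2 X3 X4.
by apply/matrixP => i j; rewrite !mxE; ring.
Qed.

Lemma conj_sub m (A B X : 'M[C]_m) :
  (A - B) *m X *m adjmx (A - B) =
  A *m X *m adjmx A + B *m X *m adjmx B
  - (A *m X *m adjmx B + B *m X *m adjmx A).
Proof.
rewrite adjmxB !(mulmxBl, mulmxBr).
move: (A *m X *m adjmx A) (A *m X *m adjmx B) (B *m X *m adjmx A)
  (B *m X *m adjmx B) => X1 X2 X3 X4.
by apply/matrixP => i j; rewrite !mxE; ring.
Qed.

Lemma tbound_unitary_conj m (V rho U : 'M[C]_m) (d : 'I_m -> C) (e : R) :
  V *m adjmx V = 1%:M -> psd rho -> \tr rho = 1 -> 0 <= e ->
  (forall j, `|d j| = 1) -> (forall j, `|1 - d j| <= e%:C) ->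
  U = adjmx V *m diag_mx (\row_j d j) *m V ->
  tbound (rho - U *m rho *m adjmx U) (2 * e).
Proof.
move=> VV prho tr1 e0 d1 de UE.
have oneE : 1%:M = adjmx V *m diag_mx (\row_j (1 : C)) *m V.
  by rewrite (_ : \row_j 1 = const_mx 1) ?diag_const_mx ?mulmx1 ?(mulmx1C VV) //;
     apply/rowP => j; rewrite !mxE.
(* [e = 0] forces [U = 1] and is treated apart, because the weight [b] below divides by [e]. *)
move: e0; rewrite le_eqVlt => /orP[/eqP e0|e0].
  have -> : U = 1%:M.
    rewrite oneE UE; congr (_ *m diag_mx _ *m _); apply/rowP => j; rewrite !mxE.
    by have := de j; rewrite -e0 normr_le0 subr_eq0 => /eqP.
  by rewrite adjmx1 mulmx1 mul1mx subrr -e0 mulr0; exact: tbound0.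
pose W := 1%:M - U; pose Z := 1%:M + U.
have WE : W = adjmx V *m diag_mx (\row_j (1 - d j)) *m V.
  rewrite /W {1}oneE UE -mulmxBl -mulmxBr -linearB /=.
  by congr (_ *m diag_mx _ *m _); apply/rowP => j; rewrite !mxE.
have ZE : Z = adjmx V *m diag_mx (\row_j (1 + d j)) *m V.
  rewrite /Z {1}oneE UE -mulmxDl -mulmxDr -linearD /=.
  by congr (_ *m diag_mx _ *m _); apply/rowP => j; rewrite !mxE.
have tW : \tr (W *m rho *m adjmx W) <= (e ^+ 2)%:C.
  by have := mxtrace_conj_le VV prho de WE; rewrite tr1 mulr1.
have tZ : \tr (Z *m rho *m adjmx Z) <= (2 ^+ 2)%:C.
  rewrite -[leRHS]mulr1 -tr1; apply: (mxtrace_conj_le VV prho _ ZE) => j.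
  rewrite (le_trans (ler_normD _ _)) // normr1 d1.
  by rewrite -[2 in leRHS](natrD R 1 1) rmorph_nat.
(* The traces of the weighted [W] term and of the [Z] term are at most [b ^+ 2 * e ^+ 2] and 4; this
   [b] makes both bounds 4. *)
pose b : R := 2 / e.
have b0 : 0 < b by rewrite divr_gt0.
(* Polarization yields [2 * b * c] times the cross terms, and half of the cross terms is wanted. *)
pose c : R := (4 * b)^-1.
have c0 : 0 <= c by rewrite invr_ge0 mulr_ge0 // ltW.
exists (c%:C *: ((b%:C *: W + Z) *m rho *m adjmx (b%:C *: W + Z))).
exists (c%:C *: ((b%:C *: W - Z) *m rho *m adjmx (b%:C *: W - Z))).
split; first by apply: psdZ => //; exact: psd_conj.
- by apply: psdZ => //; exact: psd_conj.
- rewrite -scalerBr conj_add conj_sub !adjmxZ conjc_real -!(scalemxAl, scalemxAr).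
  rewrite opprD addrACA subrr add0r opprK -scalerDr -mulr2n -scaler_nat !scalerA.
  have -> : c%:C * 2%:R * b%:C = 2^-1.
    rewrite -(rmorph_nat (real_complex R)) -!rmorphM /= -(fmorphV (real_complex R)).
    by congr (_%:C); rewrite /c; field; rewrite gt_eqF.
  rewrite /W /Z adjmxD adjmxB adjmx1.
  rewrite !(mulmxDl, mulmxDr, mulmxN, mulNmx) !mulmx1 !mul1mx.
  move: (U *m rho) (rho *m adjmx U) (U *m rho *m adjmx U) => X1 X2 X3.
  by apply/matrixP => i j; rewrite !mxE; field.
(* The trace is at most [2 * c * (4 + 4) = 4 / b = 2 * e]. *)
- rewrite -scalerDr mxtraceZ conj_add conj_sub addrACA subrr addr0.
  rewrite !adjmxZ conjc_real -!(scalemxAl, scalemxAr) scalerA.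
  rewrite -mulr2n raddfMn /= mxtraceD mxtraceZ -rmorphM.
  apply: (@le_trans _ _ (c%:C * (((b * b)%:C * (e ^+ 2)%:C + (2 ^+ 2)%:C) *+ 2))).
    rewrite ler_wpM2l ?ler0c // lerMn2r lerD // ler_wpM2l // ler0c.
    by rewrite mulr_ge0 // ltW.
  rewrite -rmorphM -rmorphD -rmorphMn -rmorphM lecR /c /b.
  by rewrite [leLHS](_ : _ = 2 * e) //; field; rewrite gt_eqF.
Qed.

End TraceNorm.

(** * The matrix exponential on diagonalized matrices *)

Section Exponential.
Local Open Scope complex_scope.
Local Open Scope classical_set_scope.
Context {R : realType}.
Local Notation C := R[i].

Definition expi (t : R) : C := cos t +i* sin t.

Lemma expiD s t : expi (s + t) = expi s * expi t.
Proof.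
by apply/eqP; rewrite eq_complex /= cosD sinD; apply/andP; split; apply/eqP; ring.
Qed.

Lemma norm_expi t : `|expi t| = 1.
Proof. by rewrite normc_def /= cos2Dsin2 sqrtr1. Qed.

(** The mean value theorem gives [sin x = x * cos c] for [x >= 0]; both squares are even in [x]. *)
Lemma sqr_sin_le (x : R) : sin x ^+ 2 <= x ^+ 2.
Proof.
wlog x0 : x / 0 <= x.
  move=> H; have [/H //|/ltW x0] := leP 0 x.
  by rewrite -sqrrN -sinN -[leRHS]sqrrN H // oppr_ge0.
have [|c _] := @MVT_segment R sin cos 0 x x0 (fun y _ => is_derive_sin y).
  by apply: continuous_subspaceT => y; exact: continuous_sin.
rewrite sin0 !subr0 => ->; rewrite exprMn ler_piMl ?sqr_ge0 //.
Qed.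

(** By the double-angle formulas the squared modulus is [4 * sin (t / 2) ^+ 2], which is at most
    [t ^+ 2]. *)
Lemma norm_1Bexpi_le t : `|1 - expi t| <= `|t|%:C.
Proof.
rewrite normc_def lecR -sqrtr_sqr ler_wsqrtr //=.
have -> : t = (t / 2) *+ 2 by rewrite -mulr_natr divfK.
move: (t / 2) => x; rewrite cos_mulr2n sin_mulr2n.
have := sqr_sin_le x; have := cos2sin2 x; move: (cos x) (sin x) => c s cE sx.
have -> : (1 - (c ^+ 2 *+ 2 - 1)) ^+ 2 + (0 - (c * s) *+ 2) ^+ 2
    = (2 - 2 * c ^+ 2) ^+ 2 + 4 * c ^+ 2 * s ^+ 2 by ring.
rewrite cE (_ : _ + _ = 4 * s ^+ 2); last by ring.
rewrite (_ : (x *+ 2) ^+ 2 = 4 * x ^+ 2); last by ring.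
by rewrite ler_wpM2l.
Qed.

(** Real and imaginary parts converge separately, matching the limits taken in [expm]. *)
Definition cvgC (u : nat -> C) (l : C) : Prop :=
  ((fun N => complex.Re (u N)) @ \oo --> complex.Re l) /\
  ((fun N => complex.Im (u N)) @ \oo --> complex.Im l).

Lemma cvgCM (c : C) u l : cvgC u l -> cvgC (fun N => c * u N) (c * l).
Proof.
move: c l => [a b] [x y] [/= hx hy]; split => /=.
  rewrite (_ : (fun N => _) = (fun N => a * complex.Re (u N) - b * complex.Im (u N))).
    by apply: cvgB; exact: cvgMl_tmp.
  by apply/funext => N; case: (u N).
rewrite (_ : (fun N => _) = (fun N => a * complex.Im (u N) + b * complex.Re (u N))).
  by apply: cvgD; exact: cvgMl_tmp.
by apply/funext => N; case: (u N).
Qed.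

Lemma cvgCD u v k l :
  cvgC u k -> cvgC v l -> cvgC (fun N => u N + v N) (k + l).
Proof.
move: k l => [a b] [x y] [/= ha hb] [/= hx hy]; split => /=.
  rewrite (_ : (fun N => _) = (fun N => complex.Re (u N) + complex.Re (v N))).
    exact: cvgD.
  by apply/funext => N; case: (u N) => ? ?; case: (v N).
rewrite (_ : (fun N => _) = (fun N => complex.Im (u N) + complex.Im (v N))).
  exact: cvgD.
by apply/funext => N; case: (u N) => ? ?; case: (v N).
Qed.

Lemma cvgC_sum (I : Type) (r : seq I) (u : I -> nat -> C) (l : I -> C) :
  (forall j, cvgC (u j) (l j)) ->
  cvgC (fun N => \sum_(j <- r) u j N) (\sum_(j <- r) l j).
Proof.
move=> h; elim: r => [|j r IH].
  rewrite big_nil (_ : (fun N => _) = fun=> 0).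
    by split => /=; exact: cvg_cst.
  by apply/funext => N; rewrite big_nil.
rewrite big_cons (_ : (fun N => _) = (fun N => u j N + \sum_(j <- r) u j N)).
  exact: cvgCD.
by apply/funext => N; rewrite big_cons.
Qed.

(** Since ['i ^+ 2 = -1], the even powers form the cosine series and the odd ones ['i] times the
    sine series. *)
Lemma cvgC_expi (t : R) :
  cvgC (fun N => \sum_(k < N) (k`!%:R)^-1 * ('i * t%:C) ^+ k) (expi t).
Proof.
have powE k : (k`!%:R : C)^-1 * ('i * t%:C) ^+ k = cos_coeff t k +i* sin_coeff t k.
  have iM (x : R) : 'i * x%:C = 0 +i* x.
    by apply/eqP; rewrite eq_complex /=; apply/andP; split; apply/eqP; ring.
  have iX h : ('i : C) ^+ h.*2 = ((-1) ^+ h)%:C.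
    by rewrite -mul2n exprM sqr_i rmorphXn /= rmorphN1.
  have iXk : ('i : C) ^+ k = if odd k then 'i * ((-1) ^+ k.-1./2)%:C
                                      else ((-1) ^+ k./2)%:C.
    rewrite -{1}(odd_double_half k); case: ifPn => ok.
      rewrite add1n exprS iX; congr ('i * ((-1) ^+ _)%:C).
      by rewrite -[in RHS](odd_double_half k) ok add1n /= doubleK.
    by rewrite add0n iX.
  rewrite exprMn iXk /cos_coeff /sin_coeff /=.
  have -> : (k`!%:R : C)^-1 = (k`!%:R^-1)%:C by rewrite fmorphV rmorph_nat.
  rewrite -(rmorphXn (real_complex R)).
  move: (k`!%:R^-1) (t ^+ k) => a b.
  case: (odd k); rewrite /= ?mul0r ?mul1r.
    have E c : a%:C * ('i * c%:C * b%:C) = 'i * (c * b * a)%:C.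
      by rewrite !(rmorphM (real_complex R)) /=; ring.
    by rewrite E iM.
  by rewrite -!(rmorphM (real_complex R)) /=; congr (_ +i* _); rewrite mulrC.
split.
  rewrite (_ : (fun N => _) = series (cos_coeff t)).
    by rewrite /expi /= unlock; exact: is_cvg_series_cos_coeff.
  apply/funext => N; rewrite (raddf_sum (@complex.Re R : Rcomplex R -> R)).
  by rewrite /series /= big_mkord; apply: eq_bigr => k _; rewrite powE.
rewrite (_ : (fun N => _) = series (sin_coeff t)).
  by rewrite /expi /= unlock; exact: is_cvg_series_sin_coeff.
apply/funext => N; rewrite (raddf_sum (@complex.Im R : Rcomplex R -> R)).
by rewrite /series /= big_mkord; apply: eq_bigr => k _; rewrite powE.
Qed.

Lemma expm_cvgC m (A L : 'M[C]_m) :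
  (forall a b, cvgC (fun N => expm_psum A N a b) (L a b)) -> expm A = L.
Proof.
move=> h; apply/matrixP => a b; rewrite mxE; case: (h a b) => hR hI.
by rewrite (cvg_lim _ hR) // (cvg_lim _ hI) // -complexE.
Qed.

(** Conjugation by [V] commutes with powers, so each entry of a partial sum is a fixed linear
    combination of scalar partial sums, which converge to [expi (t j)]. *)
Lemma expm_diag m (V : 'M[C]_m) (t : 'I_m -> R) :
  V *m adjmx V = 1%:M ->
  expm (adjmx V *m diag_mx (\row_j ('i * (t j)%:C)) *m V)
  = adjmx V *m diag_mx (\row_j expi (t j)) *m V.
Proof.
move=> VV; apply: expm_cvgC => a b.
set D := diag_mx _.
have entryE (x : 'I_m -> C) :
    (adjmx V *m diag_mx (\row_j x j) *m V) a b = \sum_j (adjmx V a j * V j b) * x j.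
  rewrite mxE; apply: eq_bigr => j _; rewrite mul_mx_diag !mxE.
  by rewrite mulrAC.
have powE k : (adjmx V *m D *m V) ^+ k =
    adjmx V *m diag_mx (\row_j (('i * (t j)%:C) ^+ k)) *m V.
  elim: k => [|k IH].
    rewrite expr0 (_ : \row_j _ = const_mx 1); last first.
      by apply/rowP => j; rewrite !mxE expr0.
    by rewrite diag_const_mx mulmx1 (mulmx1C VV).
  rewrite exprS IH -[_ * _]/(_ *m _) !mulmxA -[_ *m V *m adjmx V]mulmxA VV mulmx1.
  rewrite -[_ *m D *m diag_mx _]mulmxA mulmx_diag.
  by congr (_ *m diag_mx _ *m _); apply/rowP => j; rewrite !mxE exprS.
rewrite entryE.
rewrite (_ : (fun N => _) = fun N => \sum_j (adjmx V a j * V j b) *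
   \sum_(k < N) (k`!%:R)^-1 * ('i * (t j)%:C) ^+ k); last first.
  apply/funext => N; rewrite /expm_psum summxE.
  under eq_bigr => k _ do rewrite mxE powE entryE mulr_sumr.
  rewrite exchange_big /=; apply: eq_bigr => j _; rewrite mulr_sumr.
  by apply: eq_bigr => k _; rewrite mulrCA.
apply: cvgC_sum => j; apply: cvgCM; exact: cvgC_expi.
Qed.

End Exponential.

(** * Bit strings as matrix indices *)

Section BasisIndexing.
Context {R : realType} {Q : finType}.
Local Notation C := R[i].

Lemma sum_qbasis (F : 'I_(qdim Q) -> C) :
  \sum_i F i = \sum_(x : qbasis Q) F (enum_rank x).
Proof. by rewrite (reindex enum_rank) //; apply: onW_bij; exact: enum_rank_bij. Qed.

Lemma eq_qmx (A B : 'M[C]_(qdim Q)) :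
  (forall x y, A (enum_rank x) (enum_rank y) = B (enum_rank x) (enum_rank y)) ->
  A = B.
Proof.
by move=> h; apply/matrixP => i j; rewrite -(enum_valK i) -(enum_valK j).
Qed.

End BasisIndexing.

(** * Replacing qubits by the maximally mixed state *)

Section Twirl.
Local Open Scope complex_scope.
Context {R : realType} {n : nat}.
Local Notation C := R[i].
Local Notation op := 'M[C]_(qdim 'I_n).
Local Notation basis := (qbasis 'I_n).
Implicit Types (T : {set 'I_n}) (x y z t : basis) (X : op).

Definition merge T z x : basis := [ffun j => if j \in T then z j else x j].
(** Stands for the restriction of [x] to [T], kept as a full string so that it shares the type of
    the other indices. *)
Definition mask T x : basis := [ffun j => (j \in T) && x j].

Lemma eq_mask T x y : (mask T x == mask T y) = [forall (j | j \in T), x j == y j].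
Proof.
apply/eqP/forall_inP => [/ffunP h j jT|h].
  by have := h j; rewrite !ffunE jT /= => ->.
by apply/ffunP => j; rewrite !ffunE; case: (boolP (j \in T)) => // /h /eqP ->.
Qed.

(** Exchanging the bits of [x] and [z] in [T] is an involution on pairs that turns [merge T z x]
    into [x]; the sum over the now free [z] gives the factor. *)
Lemma sum_merge T (F : basis -> C) :
  \sum_x \sum_z F (merge T z x) = (qdim 'I_n)%:R * \sum_x F x.
Proof.
rewrite pair_big /=.
have swapK : involutive (fun p : basis * basis => (merge T p.2 p.1, merge T p.1 p.2)).
  by move=> [x z] /=; congr (_, _); apply/ffunP => j; rewrite !ffunE; case: (j \in T).
rewrite (reindex_inj (inv_inj swapK)) /=.
rewrite (eq_bigr (fun p : basis * basis => F p.1)); last first.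
  move=> [x z] _ /=; congr F; apply/ffunP => j; by rewrite !ffunE; case: (j \in T).
rewrite -(pair_bigA _ (fun x _ => F x)) /= mulr_sumr.
by apply: eq_bigr => x _; rewrite sumr_const mulr_natl; congr (_ *+ _).
Qed.

(** The operator [|t><z|] on the qubits of [T], tensored with the identity elsewhere; it is zero
    unless [t] vanishes off [T]. The bits of [z] off [T] do not matter, so summing over all [z]
    repeats each operator, and [twirl] divides by the full dimension. *)
Definition kraus T z t : op :=
  \matrix_(a, b) ((mask T (enum_val a) == t)
                  && (enum_val b == merge T z (enum_val a)))%:R.

(* Replaces the qubits of T by the maximally mixed state. *)
Definition twirl T X : op :=
  ((qdim 'I_n)%:R^-1)%:C *: \sum_(p : basis * basis)
     kraus T p.1 p.2 *m X *m adjmx (kraus T p.1 p.2).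

Lemma kraus_mul m T z t (Y : 'M[C]_(qdim 'I_n, m)) x j :
  (kraus T z t *m Y) (enum_rank x) j
  = (mask T x == t)%:R * Y (enum_rank (merge T z x)) j.
Proof.
rewrite mxE sum_qbasis (bigD1 (merge T z x)) //= big1 => [|w wm].
  by rewrite addr0 mxE !enum_rankK eqxx andbT.
by rewrite mxE !enum_rankK (negPf wm) andbF mul0r.
Qed.

Lemma kraus_conj T z t X x y :
  (kraus T z t *m X *m adjmx (kraus T z t)) (enum_rank x) (enum_rank y)
  = (mask T x == t)%:R * (mask T y == t)%:R *
    X (enum_rank (merge T z x)) (enum_rank (merge T z y)).
Proof.
rewrite -[X in _ *m X *m _]adjmxK -mulmxA -adjmxM kraus_mul adjmxE kraus_mul.
by rewrite adjmxE rmorphM /= conjcK conjc_nat mulrA.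
Qed.

Lemma twirlE T X x y :
  twirl T X (enum_rank x) (enum_rank y) =
  ((qdim 'I_n)%:R^-1)%:C * \sum_z (mask T x == mask T y)%:R *
    X (enum_rank (merge T z x)) (enum_rank (merge T z y)).
Proof.
rewrite mxE summxE; congr (_ * _).
under eq_bigr => p _ do rewrite kraus_conj.
rewrite -(pair_bigA _ (fun z t => (mask T x == t)%:R *
  (mask T y == t)%:R * X (enum_rank (merge T z x)) (enum_rank (merge T z y)))) /=.
apply: eq_bigr => z _; rewrite -mulr_suml; congr (_ * _).
(* Only [t = mask T x] contributes, and only if it is also [mask T y]. *)
rewrite (bigD1 (mask T x)) //= big1 => [|t tx].
  by rewrite eqxx mul1r addr0 eq_sym.
by rewrite eq_sym (negPf tx) mul0r.
Qed.

Lemma qdim_neq0 : (qdim 'I_n)%:R != 0 :> R.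
Proof. by rewrite pnatr_eq0 -lt0n; apply/card_gt0P; exists [ffun=> false]. Qed.

Lemma twirl_cst (a : C) : ((qdim 'I_n)%:R^-1)%:C * ((qdim 'I_n)%:R * a) = a.
Proof.
rewrite mulrA -(rmorph_nat (real_complex R)) -(rmorphM (real_complex R)).
by rewrite mulVf ?qdim_neq0 // mul1r.
Qed.

Lemma twirl_psd T X : psd X -> psd (twirl T X).
Proof.
move=> pX; apply: psdZ; first by rewrite invr_ge0.
by apply: psd_sum => p; exact: psd_conj.
Qed.

Lemma twirlB T X Y : twirl T (X - Y) = twirl T X - twirl T Y.
Proof.
rewrite /twirl -scalerBr -sumrB; congr (_ *: _).
by apply: eq_bigr => p _; rewrite mulmxBr mulmxBl.
Qed.

Lemma mxtrace_twirl T X : \tr (twirl T X) = \tr X.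
Proof.
rewrite /mxtrace !sum_qbasis; under eq_bigr => x _ do rewrite twirlE.
rewrite -mulr_sumr; under eq_bigr => x _.
  by under eq_bigr => z _ do rewrite eqxx mul1r; over.
by rewrite (sum_merge T (fun x => X (enum_rank x) (enum_rank x))) twirl_cst.
Qed.

Lemma twirl0 X : twirl finset.set0 X = X.
Proof.
apply: eq_qmx => x y; rewrite twirlE.
have m0 z w : merge finset.set0 z w = w by apply/ffunP => j; rewrite ffunE inE.
under eq_bigr => z _ do rewrite !m0.
rewrite -[RHS]twirl_cst [in RHS]mulr_natl sumr_const; congr (_ * (_ *+ _)).
have -> : mask finset.set0 x == mask finset.set0 y; last by rewrite mul1r.
by rewrite eq_mask; apply/forall_inP => j; rewrite inE.
Qed.

(** [twirl T] is linear, positive and trace preserving, so it maps a decomposition of [X] to one of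
    [twirl T X]. *)
Lemma tbound_twirl T X r : tbound X r -> tbound (twirl T X) r.
Proof.
move=> [P [N [pP pN -> lr]]]; exists (twirl T P), (twirl T N).
split; [exact: twirl_psd|exact: twirl_psd|exact: twirlB|].
by rewrite mxtraceD !mxtrace_twirl -mxtraceD.
Qed.

Lemma qext_eq (j : 'I_n) (a : qbasis {k : 'I_n | k != j}) c : qext a c j = c.
Proof. by rewrite ffunE insubF // eqxx. Qed.

Lemma qext_neq (j k : 'I_n) (a : qbasis {k : 'I_n | k != j}) c d :
  k != j -> qext a c k = qext a d k.
Proof. by move=> kj; rewrite !ffunE insubT. Qed.

(* The sums agree after exchanging the traced bit with bit j of the averaging
   string. *)
Lemma ptrace_twirl T (j : 'I_n) X : j \notin T ->
  ptrace j (twirl (j |: T) X) = ptrace j (twirl T X).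
Proof.
move=> jT; apply/matrixP => a b; rewrite !mxE.
move: (enum_val a) (enum_val b) => {}a {}b.
under eq_bigr => c _ do rewrite twirlE.
under [RHS]eq_bigr => c _ do rewrite twirlE.
rewrite -!mulr_sumr; congr (_ * _); rewrite !pair_big /=.
pose h (p : bool * basis) : bool * basis :=
  (p.2 j, [ffun k => if k == j then p.1 else p.2 k]).
have hK : involutive h.
  move=> [c z]; congr (_, _); rewrite /= ?ffunE ?eqxx //.
  by apply/ffunP => k; rewrite !ffunE; case: eqP => // ->.
rewrite [RHS](reindex_inj (inv_inj hK)) /=.
apply: eq_bigr => -[c z] _ /=; congr (_%:R * X (enum_rank _) (enum_rank _)).
- rewrite !eq_mask; congr nat_of_bool; apply/forall_inP/forall_inP => H k kT.
    have kj : k != j by apply: contraNneq jT => <-.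
    by rewrite (qext_neq _ _ c kj) (qext_neq b _ c kj) H // inE kT orbT.
  have [->|kj] := eqVneq k j; first by rewrite !qext_eq.
  move: kT; rewrite !inE (negPf kj) => /H.
  by rewrite (qext_neq _ _ c kj) (qext_neq b _ c kj).
- apply/ffunP => k; rewrite [LHS]ffunE [RHS]ffunE !inE.
  have [->|kj] := eqVneq k j; first by rewrite (negPf jT) !qext_eq.
  by rewrite /=; case: ifP => _; [rewrite ffunE (negPf kj)|exact: qext_neq].
- apply/ffunP => k; rewrite [LHS]ffunE [RHS]ffunE !inE.
  have [->|kj] := eqVneq k j; first by rewrite (negPf jT) !qext_eq.
  by rewrite /=; case: ifP => _; [rewrite ffunE (negPf kj)|exact: qext_neq].
Qed.

End Twirl.

(** * Operators acting on a subset of the qubits *)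

Section Embed.
Local Open Scope complex_scope.
Context {R : realType} {n : nat} (S : {set 'I_n}).
Local Notation C := R[i].
Local Notation op := 'M[C]_(qdim 'I_n).
Local Notation basis := (qbasis 'I_n).
Local Notation lop := 'M[C]_(qdim {j : 'I_n | j \in S}).

Implicit Types x y z p q r : basis.

Definition agree x y := [forall j, (j \notin S) ==> (x j == y j)].

Lemma agreeP x y : reflect (forall j, j \notin S -> x j = y j) (agree x y).
Proof. by apply: (iffP forall_inP) => h j /h => [/eqP|->]. Qed.

Lemma embedE (h : lop) x y : embed h (enum_rank x) (enum_rank y) =
  if agree x y then h (enum_rank (restr S x)) (enum_rank (restr S y)) else 0.
Proof. by rewrite mxE !enum_rankK. Qed.

Lemma restr_agree_inj x y : agree x y -> restr S x = restr S y -> x = y.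
Proof.
move=> /agreeP xy /ffunP rxy; apply/ffunP => j.
have [jS|/xy //] := boolP (j \in S).
by have := rxy (exist _ j jS); rewrite !ffunE.
Qed.

(** Parametrizes the strings that agree with [x] off [S] by their restrictions to [S]. *)
Definition glue (x : basis) (s : qbasis {j : 'I_n | j \in S}) : basis :=
  [ffun j => if insub j is Some j' then s j' else x j].

Lemma restr_glue x s : restr S (glue x s) = s.
Proof. by apply/ffunP => j; rewrite !ffunE valK. Qed.

Lemma agree_glue x s : agree x (glue x s).
Proof. by apply/agreeP => j jS; rewrite ffunE insubN. Qed.

Lemma agree_sym x y : agree x y = agree y x.
Proof. by apply/agreeP/agreeP => h j /h. Qed.

Lemma agree_trans y x z : agree x y -> agree y z -> agree x z.
Proof. by move=> /agreeP xy /agreeP yz; apply/agreeP => j jS; rewrite xy ?yz. Qed.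

(** In the product on the right, only intermediate strings agreeing with [x] off [S] contribute;
    these are the [glue x s], which leaves the sum over [s] of the product on the left. *)
Lemma embedM (A B : lop) : embed (A *m B) = embed A *m embed B.
Proof.
apply: eq_qmx => x y; rewrite embedE !mxE !sum_qbasis.
rewrite [RHS](bigID (agree x)) /= [X in _ = _ + X]big1 ?addr0; last first.
  by move=> r /negPf xr; rewrite embedE xr mul0r.
rewrite (reindex_onto (glue x) (restr S)); last first.
  move=> r xr; apply: restr_agree_inj; rewrite ?restr_glue //.
  by apply: agree_trans xr; rewrite agree_sym agree_glue.
rewrite [RHS](eq_bigl xpredT) => [|s]; last by rewrite /= agree_glue restr_glue eqxx.
have gy s : agree (glue x s) y = agree x y.
  apply/idP/idP; apply: agree_trans; rewrite ?agree_glue //.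
  by rewrite agree_sym agree_glue.
case: ifPn => xy.
  by apply: eq_bigr => s _; rewrite !embedE agree_glue gy xy restr_glue.
by rewrite big1 // => s _; rewrite [X in _ * X]embedE gy (negPf xy) mulr0.
Qed.

Lemma embed_adj (A : lop) : embed (adjmx A) = adjmx (embed A).
Proof.
apply: eq_qmx => x y; rewrite embedE !adjmxE embedE agree_sym.
by case: ifP => // _; rewrite conjc0.
Qed.

Lemma embed_diag (d : 'I_(qdim {j : 'I_n | j \in S}) -> C) :
  embed (diag_mx (\row_j d j)) =
  diag_mx (\row_a d (enum_rank (restr S (enum_val a)))).
Proof.
apply: eq_qmx => x y; rewrite embedE !mxE enum_rankK !(inj_eq enum_rank_inj).
have [->|xy] := eqVneq x y; last first.
  rewrite mulr0n; case: ifP => // axy.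
  by case: eqVneq => // /(restr_agree_inj axy) xy'; rewrite xy' eqxx in xy.
by rewrite eqxx (_ : agree y y) //; apply/agreeP.
Qed.

Lemma embed1 : embed (1%:M : lop) = 1%:M.
Proof.
have E m : 1%:M = diag_mx (\row_(j < m) 1) :> 'M[C]_m.
  by rewrite -diag_const_mx; congr diag_mx; apply/rowP => j; rewrite !mxE.
by rewrite !E embed_diag.
Qed.

Lemma mul_delta_entry m (A : 'M[C]_m) (i j a b : 'I_m) :
  (A *m delta_mx i j) a b = A a i * (b == j)%:R.
Proof.
rewrite mxE (bigD1 i) //= big1 => [|l li]; last by rewrite mxE (negPf li) mulr0.
by rewrite mxE eqxx addr0.
Qed.

Lemma delta_mul_entry m (A : 'M[C]_m) (i j a b : 'I_m) :
  (delta_mx i j *m A) a b = (a == i)%:R * A j b.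
Proof.
rewrite mxE (bigD1 j) //= big1 => [|l lj].
  by rewrite mxE eqxx andbT addr0.
by rewrite mxE (negPf lj) andbF mul0r.
Qed.

Lemma mxtrace_mul_delta m (Y : 'M[C]_m) (i j : 'I_m) :
  \tr (Y *m delta_mx i j) = Y j i.
Proof.
rewrite /mxtrace (bigD1 j) //= big1 => [|k kj]; rewrite mul_delta_entry.
  by rewrite eqxx mulr1 addr0.
by rewrite (negPf kj) mulr0.
Qed.

(* The operator for which [\tr (Y *m swapper x y)] is, up to a factor, the entry
   at x and y, restricted to the complement of S, of the partial trace of Y. *)
Definition swapper (x y : basis) : op :=
  \sum_z delta_mx (enum_rank (merge S z y)) (enum_rank (merge S z x)).

(** Up to a factor, [swapper x y] is the identity on [S] tensored with a matrix unit on the other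
    qubits, whereas [embed u] acts only on [S]. *)
Lemma swapper_comm (u : lop) x y :
  embed u *m swapper x y = swapper x y *m embed u.
Proof.
apply: eq_qmx => p q; rewrite /swapper mulmx_sumr mulmx_suml !summxE.
(* On [S], a nonzero term needs [z = q] in the left sum and [z = p] in the right one; this
   involution exchanges the two conditions. *)
pose s (z : basis) : basis := [ffun j => z j (+) p j (+) q j].
have sK : involutive s.
  move=> z; apply/ffunP => j; rewrite !ffunE.
  by case: (z j); case: (p j); case: (q j).
rewrite (reindex_inj (inv_inj sK)) /=; apply: eq_bigr => z _.
rewrite mul_delta_entry delta_mul_entry !(inj_eq enum_rank_inj) !embedE.
have -> : agree p (merge S (s z) y) = agree p y.
  by apply/agreeP/agreeP => h j jS; have := h j jS; rewrite !ffunE (negPf jS).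
have -> : agree (merge S z x) q = agree x q.
  by apply/agreeP/agreeP => h j jS; have := h j jS; rewrite !ffunE (negPf jS).
have -> : (q == merge S (s z) x) = (restr S z == restr S p) && agree x q.
  apply/eqP/andP => [/ffunP H|[/eqP/ffunP zp /agreeP xq]].
    split; last by apply/agreeP => j jS; have := H j; rewrite ffunE (negPf jS).
    apply/eqP/ffunP => j; have := H (val j); rewrite !ffunE (valP j).
    by case: (z _); case: (p _); case: (q _).
  apply/ffunP => j; rewrite !ffunE; case: ifPn => jS; last by rewrite xq.
  have := zp (exist _ j jS); rewrite !ffunE /= => ->.
  by rewrite addbb addFb.
have -> : (p == merge S z y) = (restr S z == restr S p) && agree p y.
  apply/eqP/andP => [/ffunP H|[/eqP/ffunP zp /agreeP py]].
    split; last by apply/agreeP => j jS; have := H j; rewrite ffunE (negPf jS).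
    by apply/eqP/ffunP => j; have := H (val j); rewrite !ffunE (valP j).
  apply/ffunP => j; rewrite ffunE; case: ifPn => jS; last by rewrite py.
  by have := zp (exist _ j jS); rewrite !ffunE.
have [zp|_] := eqVneq (restr S z) (restr S p); last by rewrite mulr0 mul0r.
have -> : restr S (merge S z x) = restr S p.
  by rewrite -zp; apply/ffunP => j; rewrite !ffunE (valP j).
have -> : restr S (merge S (s z) y) = restr S q.
  apply/ffunP => j; rewrite !ffunE (valP j).
  by move/ffunP: zp => /(_ j); rewrite !ffunE => ->; rewrite addbb addFb.
by case: (agree p y); case: (agree x q); rewrite /= ?mulr1 ?mul1r ?mulr0 ?mul0r.
Qed.

(** Entries of the twirl are multiples of traces against a [swapper]. It commutes with [embed u], so
    by cyclicity of the trace [embed u] meets its adjoint and cancels. *)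
Lemma twirl_local (u : lop) (X : op) : adjmx u *m u = 1%:M ->
  twirl S (embed u *m X *m adjmx (embed u)) = twirl S X.
Proof.
move=> uu.
have tE (Y : op) x y : \sum_z Y (enum_rank (merge S z x)) (enum_rank (merge S z y))
    = \tr (Y *m swapper x y).
  rewrite /swapper mulmx_sumr raddf_sum /=.
  by apply: eq_bigr => z _; rewrite mxtrace_mul_delta.
apply: eq_qmx => x y; rewrite !twirlE -!mulr_sumr !tE; congr (_ * (_ * _)).
rewrite -!mulmxA mxtrace_mulC !mulmxA -!mulmxA -swapper_comm.
by rewrite [adjmx _ *m _]mulmxA -embed_adj -embedM uu embed1 mul1mx.
Qed.

End Embed.

(** * Upper bounds on the W1 norm *)

Section Wasserstein.
Local Open Scope complex_scope.
Context {R : realType} {n : nat}.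
Local Notation C := R[i].
Local Notation op := 'M[C]_(qdim 'I_n).

(** A decomposition as in [W1set], with [tbound] certificates in place of trace norms, so that
    bounds add up termwise without handling the infimum. *)
Definition W1bound (A : op) (s : R) : Prop :=
  exists (X : 'I_n -> op) (r : 'I_n -> R),
    [/\ forall i, tbound (X i) (r i),
        forall i, \tr (X i) = 0,
        forall i, ptrace i (X i) = 0,
        A = \sum_i X i
      & 2^-1 * \sum_i r i <= s].

Lemma ptrace0 (i : 'I_n) : ptrace i (0 : op) = 0.
Proof. by apply/matrixP => a b; rewrite !mxE big1 // => c _; rewrite mxE. Qed.

Lemma ptraceD (i : 'I_n) (A B : op) : ptrace i (A + B) = ptrace i A + ptrace i B.
Proof.
by apply/matrixP => a b; rewrite !mxE -big_split; apply: eq_bigr => c _; rewrite mxE.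
Qed.

Lemma ptraceN (i : 'I_n) (A : op) : ptrace i (- A) = - ptrace i A.
Proof.
by apply/matrixP => a b; rewrite !mxE -sumrN; apply: eq_bigr => c _; rewrite mxE.
Qed.

Lemma W1norm_le (A : op) s : W1bound A s -> W1norm A <= s.
Proof.
move=> [X [r [tX trX pX AE rs]]].
apply: le_trans rs; apply: (@le_trans _ _ (2^-1 * \sum_i tnorm (X i))).
  apply: ge_inf.
    (* The infimum is a lower bound only once [W1set] is known to be bounded below. *)
    exists 0 => _ [Y [_ _ _ _ ->]].
    by rewrite mulr_ge0 ?invr_ge0 // sumr_ge0 // => i _; exact: tnorm_ge0.
  by exists X; split => // i; exact: tbound_herm (tX i).
rewrite ler_wpM2l ?invr_ge0 //; apply: ler_sum => i _; exact: tnorm_le.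
Qed.

Lemma W1bound0 : W1bound 0 0.
Proof.
exists (fun=> 0), (fun=> 0); split => [i|i|i||].
- exact: tbound0.
- exact: mxtrace0.
- exact: ptrace0.
- by rewrite big1.
- by rewrite big1 // mulr0.
Qed.

Lemma W1boundD (A B : op) r s :
  W1bound A r -> W1bound B s -> W1bound (A + B) (r + s).
Proof.
move=> [X [f [tX trX pX -> fr]]] [Y [g [tY trY pY -> gs]]].
exists (fun i => X i + Y i), (fun i => f i + g i); split => [i|i|i||].
- exact: tboundD.
- by rewrite mxtraceD trX trY addr0.
- by rewrite ptraceD pX pY addr0.
- by rewrite big_split.
- by rewrite big_split /= mulrDr lerD.
Qed.

(* The qubits of S are replaced by the maximally mixed state one at a time, in
   increasing order; the i-th increment is invisible once qubit i is traced out. *)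
Lemma W1bound_local (S : {set 'I_n}) (A : op) (r : R) :
  tbound A r -> twirl S A = 0 -> W1bound A (#|S|%:R * r).
Proof.
move=> tA SA.
(* The qubits of [S] already replaced after [m] steps; step [j] changes nothing when [j] is outside
   [S]. *)
pose T (m : nat) : {set 'I_n} := [set k in S | (k < m)%N]%SET.
have TS (j : 'I_n) : T j.+1 = if j \in S then j |: T j else T j.
  apply/setP => k; rewrite !inE ltnS leq_eqVlt.
  have -> : ((k : nat) == j) = (k == j) by [].
  case: (boolP (j \in S)) => jS; rewrite !inE; case: (eqVneq k j) => [->|_] //=.
    by rewrite jS.
  by rewrite (negPf jS).
exists (fun i => twirl (T i) A - twirl (T i.+1) A).
exists (fun i => (i \in S)%:R * (2 * r)).
split => [i|i|i||].
- rewrite TS; case: ifP => _; last by rewrite subrr mul0r; exact: tbound0.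
  rewrite mul1r mulr_natl mulr2n.
  by apply: tboundD; [exact: tbound_twirl|apply: tboundN; exact: tbound_twirl].
- by rewrite raddfB /= !mxtrace_twirl subrr.
- rewrite ptraceD ptraceN TS; case: ifP => _; last by rewrite subrr.
  by rewrite ptrace_twirl ?subrr // !inE ltnn andbF.
(* The sum telescopes from [twirl (T 0) A = A] to [twirl (T n) A = twirl S A = 0]. *)
- rewrite -(big_mkord xpredT (fun i => twirl (T i) A - twirl (T i.+1) A)).
  rewrite (eq_bigr (fun i => - twirl (T i.+1) A - - twirl (T i) A)); last first.
    by move=> i _; rewrite opprK addrC.
  rewrite (telescope_sumr (fun i => - twirl (T i) A)) // opprK.
  have -> : T n = S by apply/setP => k; rewrite inE ltn_ord andbT.
  have -> : T 0 = finset.set0 by apply/setP => k; rewrite !inE andbF.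
  by rewrite SA twirl0 oppr0 add0r.
- rewrite -mulr_suml -natr_sum -big_mkcond sum1_card.
  by rewrite mulrCA mulKf.
Qed.

End Wasserstein.

(** * From a single gate to a circuit *)

Section Gate.
Local Open Scope complex_scope.
Context {R : realType}.
Local Notation C := R[i].

(** The point [c] is the midpoint of the spectrum, whose half-width is [espread h]. *)
Lemma espread_diag m (V : 'M[C]_m) (d : 'I_m -> R) (h : 'M[C]_m) :
  V *m adjmx V = 1%:M -> h = adjmx V *m diag_mx (\row_j (d j)%:C) *m V ->
  exists c : R, forall j, `|d j - c| <= espread h.
Proof.
move=> VV hE.
pose E := [set r : R | eigenvalue h r%:C]%classic.
have Ed j : E (d j).
  apply/eigenvalueP; exists (row j V).
    rewrite -row_mul hE !mulmxA VV mul1mx; apply/rowP => k.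
    by rewrite mul_diag_mx !mxE.
  apply/eqP => rV0; have : (V *m adjmx V) j j = 1 by rewrite VV mxE eqxx.
  rewrite mxE big1 => [/eqP|k _]; first by rewrite eq_sym oner_eq0.
  by have /rowP/(_ k) := rV0; rewrite !mxE => ->; rewrite mul0r.
(* For a left eigenvector [v], any nonzero coordinate of [v *m adjmx V] picks out such a [j]. Thus
   the spectrum is bounded, and its [sup] and [inf] are true bounds. *)
have dE r : E r -> exists j, r = d j.
  move=> /eigenvalueP[v vh v0].
  have : v *m adjmx V != 0.
    apply: contraNneq v0 => vV0.
    by rewrite -[v]mulmx1 -(mulmx1C VV) mulmxA vV0 mul0mx.
  move=> /rV0Pn[j wj]; exists j; apply: (@complexI R).
  have : v *m h *m adjmx V = r%:C *: (v *m adjmx V) by rewrite vh -scalemxAl.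
  rewrite hE !mulmxA -[_ *m V *m adjmx V]mulmxA VV mulmx1.
  move: (v *m adjmx V) wj => w wj /rowP/(_ j); rewrite mul_mx_diag !mxE => wE.
  by apply: (mulIf wj); rewrite -wE mulrC.
have dB j : `|d j| <= \sum_i `|d i|.
  by rewrite (bigD1 j) //= lerDl sumr_ge0.
have ubE : has_ubound E.
  exists (\sum_i `|d i|) => _ /dE[j ->]; exact: le_trans (ler_norm _) (dB j).
have lbE : has_lbound E.
  by exists (- \sum_i `|d i|) => _ /dE[j ->];
    rewrite lerNl (le_trans _ (dB j)) // -normrN ler_norm.
exists ((sup E + inf E) / 2) => j; rewrite /espread -/E.
have := ub_le_sup ubE (Ed j); have := ge_inf lbE (Ed j).
by rewrite ler_norml; lra.
Qed.

(** The pure state of a basis vector; it makes the set under the supremum in [CW1] nonempty. *)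
Lemma density_exists m (i : 'I_m) : exists rho : 'M[C]_m, density rho.
Proof.
pose v : 'cV[C]_m := delta_mx i 0.
have p1 : psd (1%:M : 'M[C]_1).
  split; first exact: adjmx1.
  by move=> w; rewrite mulmx1 mxE big_ord1 adjmxE mulrC mulcJ_ge0.
exists (v *m 1%:M *m adjmx v); split; first exact: psd_conj.
rewrite mulmx1 mxtrace_mulC /mxtrace big_ord1 mxE (bigD1 i) //= big1 => [|j ji].
  by rewrite adjmxE !mxE !eqxx conjc_nat mulr1 addr0.
by rewrite [v j _]mxE (negPf ji) mulr0.
Qed.

(** The first conclusion lets the next gate be applied to the output state. *)
Lemma gate_W1bound n (g : gate R n) (rho : 'M[C]_(qdim 'I_n)) :
  herm (gham g) -> 0 <= gtime g -> density rho ->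
  density (gU g *m rho *m adjmx (gU g)) /\
  W1bound (rho - gU g *m rho *m adjmx (gU g))
    (2 * (#|gsupp g|%:R * espread (gham g) * gtime g)).
Proof.
case: g => S h T /= hh T0 [prho tr1].
rewrite /gU /gH /=.
have [V [d [VV1 VV2 hE]]] := herm_spectral hh.
have [c dc] := espread_diag VV1 hE.
pose eV := embed V.
have eVV : eV *m adjmx eV = 1%:M by rewrite -embed_adj -embedM VV1 embed1.
pose r (a : 'I_(qdim 'I_n)) := enum_rank (restr S (enum_val a)).
pose u := adjmx V *m diag_mx (\row_j expi (- (T * d j))) *m V.
(* Embedding a diagonalization of [h] diagonalizes [embed h], so exponentiation commutes with
   [embed]. *)
have UE : expm (- ('i * T%:C) *: embed h) = embed u.
  have -> : embed u = adjmx eV *m diag_mx (\row_a expi (- (T * d (r a)))) *m eV.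
    by rewrite /u !embedM embed_adj embed_diag.
  have -> : - ('i * T%:C) *: embed h
      = adjmx eV *m diag_mx (\row_a ('i * (- (T * d (r a)))%:C)) *m eV.
    rewrite hE !embedM embed_adj embed_diag scalemxAl scalemxAr.
    set D1 := _ *: _; set D2 := diag_mx _; suff -> : D1 = D2 by [].
    apply/matrixP => a b; rewrite !mxE.
    case: eqP => _; rewrite ?mulr0n ?mulr0 // !mulr1n.
    by rewrite rmorphN rmorphM /= mulrN mulNr mulrA.
  exact: expm_diag.
have uu : adjmx u *m u = 1%:M.
  rewrite /u !adjmxM adjmxK !mulmxA -[_ *m V *m adjmx V]mulmxA VV1 mulmx1.
  rewrite -[adjmx V *m _ *m _]mulmxA.
  rewrite (_ : adjmx (diag_mx _) *m diag_mx _ = 1%:M) ?mulmx1 //.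
  rewrite /adjmx map_diag_mx tr_diag_mx mulmx_diag -diag_const_mx; congr diag_mx.
  by apply/rowP => j; rewrite !mxE mulrC -sqr_normc norm_expi expr1n.
rewrite {}UE; set U := embed u.
have UU : adjmx U *m U = 1%:M by rewrite -embed_adj -embedM uu embed1.
split.
  split; first exact: psd_conj.
  by rewrite mxtrace_mulC mulmxA UU mul1mx.
have -> : 2 * (#|S|%:R * espread h * T) = #|S|%:R * (2 * (espread h * T)) by ring.
apply: W1bound_local; last by rewrite twirlB twirl_local // subrr.
(* A global phase leaves the conjugation unchanged and centres the phases of the eigenvalues, which
   then lie within [espread h * T] of 0. *)
pose U' := expi (T * c) *: U.
have -> : U *m rho *m adjmx U = U' *m rho *m adjmx U'.
  rewrite /U' adjmxZ -!(scalemxAl, scalemxAr) scalerA -sqr_normc norm_expi.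
  by rewrite expr1n scale1r.
have U'E : U' = adjmx eV *m diag_mx (\row_a expi (- (T * (d (r a) - c)))) *m eV.
  rewrite /U' /U /u !embedM embed_adj embed_diag scalemxAl scalemxAr.
  set D1 := _ *: _; set D2 := diag_mx _; suff -> : D1 = D2 by [].
  apply/matrixP => a b; rewrite !mxE.
  case: eqP => _; rewrite ?mulr0n ?mulr0 // !mulr1n -expiD; congr expi.
  by rewrite /r; ring.
have dcT a : `|- (T * (d (r a) - c))| <= espread h * T.
  by rewrite normrN normrM (ger0_norm T0) mulrC ler_wpM2r.
apply: (tbound_unitary_conj eVV prho tr1 _ _ _ U'E) => [|a|a].
(* Any index shows that [espread h * T] is nonnegative; the all-zero string provides one for every
   [n]. *)
- apply: le_trans (dcT (enum_rank [ffun=> false])); exact: normr_ge0.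
- exact: norm_expi.
- by apply: le_trans (norm_1Bexpi_le _) _; rewrite lecR.
Qed.

(** [V] accumulates the gates already applied, so the induction follows [foldl] and the differences
    between successive states telescope. *)
Lemma circuit_W1bound n (gs : seq (gate R n)) (rho V : 'M[C]_(qdim 'I_n)) :
  (forall g, List.In g gs -> herm (gham g) /\ 0 <= gtime g) ->
  density (V *m rho *m adjmx V) ->
  let U := foldl (fun U g => gU g *m U) V gs in
  W1bound (V *m rho *m adjmx V - U *m rho *m adjmx U) (2 * cost gs).
Proof.
elim: gs V => [|g gs IH] V hgs dV /=.
  by rewrite subrr /cost big_nil mulr0; exact: W1bound0.
have [hg tg] := hgs g (or_introl erefl).
have [dg wg] := gate_W1bound hg tg dV.
have gVE : gU g *m V *m rho *m adjmx (gU g *m V)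
    = gU g *m (V *m rho *m adjmx V) *m adjmx (gU g) by rewrite adjmxM !mulmxA.
rewrite -gVE in dg wg.
have := W1boundD wg (IH _ (fun g' h => hgs g' (or_intror h)) dg).
by rewrite addrA subrK -mulrDr /cost big_cons.
Qed.

End Gate.

(** * Supremum over the input states *)

Theorem theorem3 (R : realType) (n : nat) (gs : seq (gate R n)) :
  (forall g, List.In g gs -> herm (gham g) /\ 0 <= gtime g) ->
  CW1 (circuit gs) / 2 <= cost gs.
Proof.
move=> hgs; rewrite ler_pdivrMr // mulrC.
apply: ge_sup => [|_ [rho [drho ->]]].
  have [rho drho] := @density_exists R _ (enum_rank ([ffun=> false] : qbasis 'I_n)).
  by exists (W1norm (rho - circuit gs *m rho *m adjmx (circuit gs))), rho.
apply: W1norm_le.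
have dV : density (1%:M *m rho *m adjmx 1%:M) by rewrite adjmx1 mul1mx mulmx1.
by have := circuit_W1bound hgs dV; rewrite adjmx1 mul1mx mulmx1.
Qed.
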